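(* Let $(V^\varepsilon,U^\varepsilon,\Theta^\varepsilon)(\xi)$ be the $3$-viscous shock wave connecting $(v_-,u_-,\theta_-)$ to $(v_+,u_+,\theta_+)$, with strength $\delta=|p_--p_+|$, and let $P^\varepsilon=R\Theta^\varepsilon/V^\varepsilon$. Then there exists a positive constant $C$, independent of $\delta$, $\varepsilon$ and $\xi$, such that for all $\xi\in\mathbb R$ $$\left|\frac{V^\varepsilon-v_-}{P^\varepsilon-p_-}-\frac{V^\varepsilon-v_+}{P^\varepsilon-p_+}-\frac{\gamma+1}{2\gamma p_+}\,\frac{R\varepsilon\gamma}{\kappa(\gamma-1)^2+R\varepsilon\gamma}\,(v_+-v_-)\right|\le C\delta^2 .$$
   Context: $R>0$, $\gamma>1$ are constants; $\varepsilon>0$ is the viscosity and $\kappa=\kappa(\varepsilon)>0$ the heat conductivity, with $\kappa/\varepsilon$ bounded above and bounded below by positive constants. The right state $(v_+,u_+,\theta_+)$, $v_+,\theta_+>0$, is fixed, and $p_\pm=R\theta_\pm/v_\pm$, $\lambda_3(v,\theta)=\sqrt{\gamma R\theta}/v$. The left state $(v_-,u_-,\theta_-)$, $v_-,\theta_->0$, is joined to the right state by a $3$-shock: there is a constant $s_3$ with $$-s_3(v_+-v_-)-(u_+-u_-)=0,\quad -s_3(u_+-u_-)+(p_+-p_-)=0,\quad -s_3\Big[\tfrac{R\theta_+}{\gamma-1}+\tfrac{u_+^2}{2}-\tfrac{R\theta_-}{\gamma-1}-\tfrac{u_-^2}{2}\Big]+(p_+u_+-p_-u_-)=0$$ and $\lambda_3(v_+,\theta_+)<s_3<\lambda_3(v_-,\theta_-)$.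 The $3$-viscous shock wave $(V^\varepsilon,U^\varepsilon,\Theta^\varepsilon)(\xi)$, $\xi=x-s_3t$, is the smooth solution (unique up to translation in $\xi$), with $'=d/d\xi$, of $$-s_3(V^\varepsilon)'-(U^\varepsilon)'=0,\qquad -s_3(U^\varepsilon)'+(P^\varepsilon)'=\varepsilon\Big(\frac{(U^\varepsilon)'}{V^\varepsilon}\Big)',$$ $$-s_3\Big(\frac{R\Theta^\varepsilon}{\gamma-1}+\frac{(U^\varepsilon)^2}{2}\Big)'+(P^\varepsilon U^\varepsilon)'=\kappa\Big(\frac{(\Theta^\varepsilon)'}{V^\varepsilon}\Big)'+\varepsilon\Big(\frac{(U^\varepsilon)'U^\varepsilon}{V^\varepsilon}\Big)',$$ with $(V^\varepsilon,U^\varepsilon,\Theta^\varepsilon)(\pm\infty)=(v_\pm,u_\pm,\theta_\pm)$. *)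

(* Defs.v *)
(* Stdlib reals with Coquelicot.  The gas constant is written [Rg], since [R]
   is the type of reals. *)
From Stdlib Require Import Reals.
From Coquelicot Require Import Coquelicot.
Open Scope R_scope.

Definition pressure (Rg v theta : R) : R := Rg * theta / v.

Definition lambda3 (Rg gam v theta : R) : R := sqrt (gam * Rg * theta) / v.

(* Total energy per unit mass. *)
Definition energy (Rg gam u theta : R) : R :=
  Rg * theta / (gam - 1) + u ^ 2 / 2.

(* Rankine-Hugoniot conditions and Lax entropy condition of a 3-shock with
   left state (vm, um, thm), right state (vp, up, thp) and speed s3. *)
Record is_3shock (Rg gam vm um thm vp up thp s3 : R) : Prop := {
  shock_mass : - s3 * (vp - vm) - (up - um) = 0;
  shock_momentum :
    - s3 * (up - um) + (pressure Rg vp thp - pressure Rg vm thm) = 0;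
  shock_energy :
    - s3 * (energy Rg gam up thp - energy Rg gam um thm)
    + (pressure Rg vp thp * up - pressure Rg vm thm * um) = 0;
  shock_lax :
    lambda3 Rg gam vp thp < s3 < lambda3 Rg gam vm thm
}.

Definition smooth (f : R -> R) : Prop :=
  forall (n : nat) (x : R), ex_derive_n f n x.

(* Coquelicot's [Derive] is total; here every differentiated function is
   smooth because V, U, Th are smooth and V does not vanish. *)
Record is_viscous_3shock
    (Rg gam eps kap vm um thm vp up thp s3 : R) (V U Th : R -> R) : Prop := {
  visc_smooth_V : smooth V;
  visc_smooth_U : smooth U;
  visc_smooth_Th : smooth Th;
  visc_V_pos : forall xi, 0 < V xi;
  visc_Th_pos : forall xi, 0 < Th xi;
  visc_mass : forall xi, - s3 * Derive V xi - Derive U xi = 0;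
  visc_momentum : forall xi,
    - s3 * Derive U xi + Derive (fun y => pressure Rg (V y) (Th y)) xi
    = eps * Derive (fun y => Derive U y / V y) xi;
  visc_energy : forall xi,
    - s3 * Derive (fun y => energy Rg gam (U y) (Th y)) xi
    + Derive (fun y => pressure Rg (V y) (Th y) * U y) xi
    = kap * Derive (fun y => Derive Th y / V y) xi
      + eps * Derive (fun y => Derive U y * U y / V y) xi;
  visc_V_left : is_lim V m_infty vm;
  visc_U_left : is_lim U m_infty um;
  visc_Th_left : is_lim Th m_infty thm;
  visc_V_right : is_lim V p_infty vp;
  visc_U_right : is_lim U p_infty up;
  visc_Th_right : is_lim Th p_infty thp
}.

(* Main.v *)
Require Import Defs.
From Stdlib Require Import Reals Lra Psatz.
From Coquelicot Require Import Coquelicot.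
Open Scope R_scope.

(** Write [x = V - vm], [y = vp - V], [pp = p_+], [s] for the shock speed and
    [del = s^2 (vp - vm)], which is the strength.  One integration turns the
    profile equations into a planar system
    [eps s V' = - V F1], [kap Th' = - s V F2], where
    [F1 = P - pm + s^2 x] and [F2] measure how far the profile is from the
    Rayleigh line and from the integrated energy balance
    ([planar_profile_of_viscous_shock]).

    The first half is qualitative: [F1 < 0 < F2] along the whole profile
    ([shock_profile_region]).  The pair [(F1, F2)] solves a linear system with
    negative coupling, so that, up to an integrating factor, the product
    [- F1 F2] increases.  If it were nonpositive somewhere it would be negative
    ever before, and the profile could not issue from the left state.
    Consequently [vm < V < vp], and neither denominator of the statement
    vanishes.

    The second half is quantitative.  Put [F1 = - psi s^4 x y].  Then
    [P - pm = - s^2 x (1 + s^2 y psi)] and [P - pp = s^2 y (1 - s^2 x psi)], so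
    the difference of the two quotients is
    [psi (vp - vm) / ((1 - s^2 x psi) (1 + s^2 y psi))], and everything reduces
    to finding [psi] up to [O(del)] ([chord_difference_estimate]).  The sign
    [F2 > 0] bounds [psi], uniformly for all strengths; and [psi] obeys a
    relaxation equation [eps s psi' = source - psi * damping] in which the
    damping differs by [O(del)] from a constant.  A bounded solution on the
    whole line of such an equation stays within [O(del)] of the equilibrium
    [source / damping] ([scaled_defect_close]), and this equilibrium is the
    coefficient [(gam + 1) / (2 gam pp) * Rg eps gam /
    (kap (gam - 1)^2 + Rg eps gam)].

    The lower bound on [kap / eps] keeps the constants independent of [eps].
    Strong shocks need no separate theory: [psi] and its limit have a common
    bound, [vp - vm < vp], and the loss in [1 - s^2 x psi] is at most linear in
    the strength ([pressure_margin]). *)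

(** * One-dimensional calculus *)

Lemma is_derive_continuity_pt (f : R -> R) (x l : R) :
  is_derive f x l -> continuity_pt f x.
Proof.
  intros Hf. apply continuity_pt_filterlim, (ex_derive_continuous f x).
  exists l; exact Hf.
Qed.

Lemma derive_value (f : R -> R) (x l : R) : is_derive f x l -> Derive f x = l.
Proof. exact (is_derive_unique f x l). Qed.

Lemma mean_value (f df : R -> R) (a b : R) :
  (forall x, is_derive f x (df x)) -> a <= b ->
  exists c, a <= c <= b /\ f b - f a = df c * (b - a).
Proof.
  intros Hf Hab.
  destruct (MVT_gen f a b df) as [c [Hc Heq]].
  - intros x _. apply Hf.
  - intros x _. exact (is_derive_continuity_pt f x _ (Hf x)).
  - rewrite Rmin_left, Rmax_right in Hc by lra. exists c; split; assumption.
Qed.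

Lemma nondecreasing_of_derive (f df : R -> R) :
  (forall x, is_derive f x (df x)) -> (forall x, 0 <= df x) ->
  forall a b, a <= b -> f a <= f b.
Proof.
  intros Hf Hpos a b Hab.
  destruct (mean_value f df a b Hf Hab) as [c [_ Heq]].
  specialize (Hpos c). nra.
Qed.

Lemma increasing_of_derive (f df : R -> R) :
  (forall x, is_derive f x (df x)) -> (forall x, 0 < df x) ->
  forall a b, a < b -> f a < f b.
Proof.
  intros Hf Hpos a b Hab.
  destruct (mean_value f df a b Hf (Rlt_le _ _ Hab)) as [c [_ Heq]].
  specialize (Hpos c). nra.
Qed.

Lemma constant_of_derive (f : R -> R) :
  (forall x, is_derive f x 0) -> forall a b, f a = f b.
Proof.
  intros Hf.
  assert (H : forall a b, a <= b -> f a = f b).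
  { intros a b Hab.
    destruct (mean_value f (fun _ => 0) a b Hf Hab) as [c [_ Heq]]. lra. }
  intros a b. destruct (Rle_dec a b) as [Hab|Hab].
  - apply H; lra.
  - symmetry; apply H; lra.
Qed.

Lemma antiderivative_exists (m : R -> R) :
  (forall x, continuous m x) -> exists I : R -> R, forall x, is_derive I x (m x).
Proof.
  intros Hm. exists (fun x => RInt m 0 x). intros x.
  apply (is_derive_RInt m _ 0 x); [|apply Hm].
  apply filter_forall. intros y.
  apply (RInt_correct m 0 y), (ex_RInt_continuous m 0 y). intros z _. apply Hm.
Qed.

Lemma integrating_factor (m : R -> R) :
  (forall x, continuous m x) ->
  exists mu : R -> R, (forall x, 0 < mu x) /\
    (forall x, is_derive mu x (mu x * m x)).
Proof.
  intros Hm. destruct (antiderivative_exists m Hm) as [I HI].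
  exists (fun x => exp (I x)). split.
  - intros x; apply exp_pos.
  - intros x. specialize (HI x). auto_derive.
    + exists (m x); exact HI.
    + rewrite (derive_value (fun y => I y) x _ HI). ring.
Qed.

Lemma is_derive_weighted (mu f : R -> R) (x m df : R) :
  is_derive mu x (mu x * m) -> is_derive f x df ->
  is_derive (fun y => mu y * f y) x (mu x * (df + m * f x)).
Proof.
  intros Hmu Hf. auto_derive.
  - repeat split; [exists (mu x * m); exact Hmu | exists df; exact Hf].
  - rewrite (derive_value (fun y => mu y) x _ Hmu),
      (derive_value (fun y => f y) x _ Hf). ring.
Qed.

(** With an integrating factor for [m], the hypothesis says that a positive
    multiple of [f] is nondecreasing, so [f] can never become negative again. *)
Lemma positive_persists (f df m : R -> R) (a : R) :
  (forall x, is_derive f x (df x)) -> (forall x, continuous m x) ->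
  (forall x, 0 <= df x + m x * f x) ->
  0 < f a -> forall x, a <= x -> 0 < f x.
Proof.
  intros Hf Hm Hineq Ha x Hx.
  destruct (integrating_factor m Hm) as [mu [Hmu Hdmu]].
  assert (Hle : mu a * f a <= mu x * f x).
  { apply (nondecreasing_of_derive (fun y => mu y * f y)
             (fun y => mu y * (df y + m y * f y))); [| |exact Hx].
    - intros y. apply is_derive_weighted; auto.
    - intros y. apply Rmult_le_pos; [apply Rlt_le, Hmu | apply Hineq]. }
  pose proof (Hmu a); pose proof (Hmu x).
  assert (0 < mu a * f a) by (apply Rmult_lt_0_compat; assumption).
  apply (Rmult_lt_reg_l (mu x)); lra.
Qed.

(** The two lemmas below read this monotonicity backwards.  Information about a
    profile is available at minus infinity, so signs must be transported to the
    left. *)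
Lemma nonpos_before (f df m : R -> R) (a : R) :
  (forall x, is_derive f x (df x)) -> (forall x, continuous m x) ->
  (forall x, 0 <= df x + m x * f x) ->
  f a <= 0 -> forall x, x <= a -> f x <= 0.
Proof.
  intros Hf Hm Hineq Ha x Hx. apply Rnot_lt_le; intros Hpos.
  pose proof (positive_persists f df m x Hf Hm Hineq Hpos a Hx). lra.
Qed.

Lemma negative_before (f df m : R -> R) (a : R) :
  (forall x, is_derive f x (df x)) -> (forall x, continuous m x) ->
  (forall x, 0 < df x + m x * f x) ->
  f a <= 0 -> forall x, x < a -> f x < 0.
Proof.
  intros Hf Hm Hineq Ha x Hx.
  destruct (integrating_factor m Hm) as [mu [Hmu Hdmu]].
  assert (Hlt : mu x * f x < mu a * f a).
  { apply (increasing_of_derive (fun y => mu y * f y)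
             (fun y => mu y * (df y + m y * f y))); [| |exact Hx].
    - intros y. apply is_derive_weighted; auto.
    - intros y. apply Rmult_lt_0_compat; [apply Hmu | apply Hineq]. }
  pose proof (Hmu a); pose proof (Hmu x). nra.
Qed.

(** Gronwall in both directions of time: this is the uniqueness theorem that
    keeps a profile from reaching a rest point in finite time. *)
Lemma zero_spreads (f df m : R -> R) (a : R) :
  (forall x, is_derive f x (df x)) -> (forall x, continuous m x) ->
  (forall x, 0 <= f x) -> (forall x, Rabs (df x) <= m x * f x) ->
  f a = 0 -> forall x, f x = 0.
Proof.
  intros Hf Hm Hpos Hineq Ha x.
  apply Rle_antisym; [|apply Hpos].
  destruct (Rle_dec x a) as [Hx|Hx].
  - apply (nonpos_before f df m a); auto; [|lra].
    intros y. pose proof (Hineq y) as H. apply Rabs_le_between in H. lra.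
  - apply Rnot_lt_le; intros Hfx.
    destruct (integrating_factor (fun y => - m y)) as [mu [Hmu Hdmu]].
    { intros y. apply (continuous_opp m), Hm. }
    assert (Hle : mu x * f x <= mu a * f a).
    { apply Ropp_le_cancel.
      apply (nondecreasing_of_derive (fun y => - (mu y * f y))
             (fun y => - (mu y * (df y + - m y * f y)))); [| |lra].
      - intros y. apply (is_derive_opp (fun z => mu z * f z)).
        apply is_derive_weighted; auto.
      - intros y. pose proof (Hmu y). pose proof (Hineq y) as H'.
        apply Rabs_le_between in H'. nra. }
    pose proof (Hmu x). rewrite Ha in Hle. nra.
Qed.

(** A damped quantity that were positive somewhere would have to grow at least
    exponentially towards minus infinity, so boundedness on the whole line
    forces its sign.  This replaces the asymptotic analysis of a profile at its
    starting rest point. *)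
Lemma bounded_damped_nonpos (f df m : R -> R) (b M : R) :
  (forall x, is_derive f x (df x)) -> (forall x, continuous m x) ->
  0 < b -> (forall x, b <= m x) -> (forall x, f x <= M) ->
  (forall x, df x + m x * f x <= 0) -> forall x, f x <= 0.
Proof.
  intros Hf Hm Hb Hmb HM Hineq x0. apply Rnot_lt_le; intros Hpos.
  destruct (antiderivative_exists m Hm) as [I HI].
  pose proof (HM x0) as HM0.
  (* Far enough to the left for the linear lower bound (1 + b (x0 - x)) f(x0)
     to exceed M. *)
  set (x := x0 - M / (f x0 * b)).
  assert (Hx : x < x0).
  { unfold x. assert (0 < M / (f x0 * b)); [|lra].
    apply Rdiv_lt_0_compat; [lra|]. now apply Rmult_lt_0_compat. }
  assert (HIx : b * (x0 - x) <= I x0 - I x).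
  { destruct (mean_value I m x x0 HI) as [c [_ ->]]; [lra|].
    specialize (Hmb c). nra. }
  assert (Hle : exp (I x0) * f x0 <= exp (I x) * f x).
  { apply Ropp_le_cancel.
    apply (nondecreasing_of_derive (fun y => - (exp (I y) * f y))
             (fun y => - (exp (I y) * (df y + m y * f y)))); [| |lra].
    - intros y. apply (is_derive_opp (fun z => exp (I z) * f z)).
      apply (is_derive_weighted (fun z => exp (I z))); [|auto].
      specialize (HI y). auto_derive.
      + exists (m y); exact HI.
      + rewrite (derive_value (fun z => I z) y _ HI). ring.
    - intros y. pose proof (exp_pos (I y)). pose proof (Hineq y). nra. }
  assert (Hge : (1 + b * (x0 - x)) * f x0 <= f x).
  { pose proof (exp_ineq1_le (I x0 - I x)) as He.
    replace (I x0) with ((I x0 - I x) + I x) in Hle by ring.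
    rewrite exp_plus in Hle.
    pose proof (exp_pos (I x)) as HeI.
    assert (exp (I x0 - I x) * f x0 <= f x); [|nra].
    apply (Rmult_le_reg_l (exp (I x))); [exact HeI|]. lra. }
  assert (b * (x0 - x) * f x0 = M).
  { unfold x. field. lra. }
  pose proof (HM x). lra.
Qed.

(** The increments of [f] over unit intervals tend to zero, and each of them is
    a value of [df]. *)
Lemma lim_derive_m_infty (f df : R -> R) (l l' : R) :
  (forall x, is_derive f x (df x)) ->
  is_lim f m_infty l -> is_lim df m_infty l' -> l' = 0.
Proof.
  intros Hf Hl Hl'.
  apply is_lim_spec in Hl. apply is_lim_spec in Hl'. simpl in Hl, Hl'.
  destruct (Req_dec l' 0) as [|Hne]; [assumption|exfalso].
  assert (He : 0 < Rabs l' / 4) by (pose proof (Rabs_pos_lt l' Hne); lra).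
  destruct (Hl (mkposreal _ He)) as [A1 HA1].
  destruct (Hl' (mkposreal _ He)) as [A2 HA2]. simpl in HA1, HA2.
  set (a := Rmin A1 A2 - 2).
  assert (Ha1 : a + 1 < A1) by (unfold a; pose proof (Rmin_l A1 A2); lra).
  assert (Ha2 : a + 1 < A2) by (unfold a; pose proof (Rmin_r A1 A2); lra).
  destruct (mean_value f df a (a + 1) Hf) as [c [Hc Heq]]; [lra|].
  pose proof (HA1 a ltac:(lra)) as H1. pose proof (HA1 (a + 1) ltac:(lra)) as H2.
  pose proof (HA2 c ltac:(lra)) as H3.
  revert H1 H2 H3 He. unfold Rabs. repeat destruct Rcase_abs; intros; lra.
Qed.

Lemma is_lim_div_R (f g : R -> R) (x : Rbar) (lf lg : R) :
  is_lim f x lf -> is_lim g x lg -> lg <> 0 ->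
  is_lim (fun y => f y / g y) x (lf / lg).
Proof.
  intros Hf Hg Hne.
  apply (is_lim_div f g x lf lg Hf Hg); [|exact I].
  intros Heq; apply Hne. now injection Heq.
Qed.

Lemma is_lim_mult_R (f g : R -> R) (x : Rbar) (lf lg : R) :
  is_lim f x lf -> is_lim g x lg -> is_lim (fun y => f y * g y) x (lf * lg).
Proof. intros Hf Hg. exact (is_lim_mult f g x lf lg Hf Hg I). Qed.

(** An integrated viscous equation only shows that the diffusive flux
    [df / v] has a limit; as [f] itself converges, that limit is zero.  This
    determines the constant of integration. *)
Lemma flux_vanishes (f df v : R -> R) (lf lv l : R) :
  (forall x, is_derive f x (df x)) -> (forall x, 0 < v x) ->
  is_lim f m_infty lf -> is_lim v m_infty lv ->
  is_lim (fun x => df x / v x) m_infty l -> l * lv = 0.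
Proof.
  intros Hf Hv Hlf Hlv Hl.
  apply (lim_derive_m_infty f df lf (l * lv) Hf Hlf).
  apply is_lim_ext with (fun x => df x / v x * v x).
  - intros x. field. pose proof (Hv x). lra.
  - apply is_lim_mult_R; assumption.
Qed.

Lemma eq_of_constant_lim (f : R -> R) (l : R) :
  (forall a b, f a = f b) -> is_lim f m_infty l -> forall x, f x = l.
Proof.
  intros Hc Hl x.
  apply (is_lim_ext f (fun _ => f x)) in Hl; [|intros y; apply Hc].
  apply is_lim_unique in Hl. rewrite Lim_const in Hl. now injection Hl.
Qed.

Lemma is_lim_m_infty_near (f : R -> R) (l e x : R) :
  is_lim f m_infty l -> 0 < e -> exists a, a <= x /\ Rabs (f a - l) < e.
Proof.
  intros Hl He. apply is_lim_spec in Hl.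
  destruct (Hl (mkposreal e He)) as [A HA]. simpl in HA.
  exists (Rmin (A - 1) x). split; [apply Rmin_r|].
  apply HA. pose proof (Rmin_l (A - 1) x). lra.
Qed.

Lemma nonincreasing_le_lim (f df : R -> R) (l a : R) :
  (forall x, is_derive f x (df x)) -> (forall x, x <= a -> df x <= 0) ->
  is_lim f m_infty l -> f a <= l.
Proof.
  intros Hf Hneg Hl. apply Rnot_lt_le; intros Hlt.
  destruct (is_lim_m_infty_near f l (f a - l) a Hl) as [b [Hb Hfb]]; [lra|].
  destruct (mean_value f df b a Hf Hb) as [c [Hc Heq]].
  specialize (Hneg c (proj2 Hc)). apply Rabs_lt_between in Hfb. nra.
Qed.

Lemma nondecreasing_ge_lim (f df : R -> R) (l a : R) :
  (forall x, is_derive f x (df x)) -> (forall x, x <= a -> 0 <= df x) ->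
  is_lim f m_infty l -> l <= f a.
Proof.
  intros Hf Hpos Hl. apply Ropp_le_cancel.
  apply (nonincreasing_le_lim (fun x => - f x) (fun x => - df x) (- l) a).
  - intros x. apply (is_derive_opp f), Hf.
  - intros x Hx. specialize (Hpos x Hx). lra.
  - exact (is_lim_opp f m_infty l Hl).
Qed.

(** The squared norm of the solution satisfies a linear differential inequality
    whose rate is controlled by the coefficients. *)
Lemma linear_system_zero (f g a b c d : R -> R) (x0 : R) :
  (forall x, is_derive f x (a x * f x + b x * g x)) ->
  (forall x, is_derive g x (c x * f x + d x * g x)) ->
  (forall x, continuous a x) -> (forall x, continuous b x) ->
  (forall x, continuous c x) -> (forall x, continuous d x) ->
  f x0 = 0 -> g x0 = 0 -> forall x, f x = 0.
Proof.
  intros Hf Hg Ha Hb Hc Hd Hf0 Hg0 x.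
  assert (Hsq : forall u : R -> R, (forall y, continuous u y) ->
            forall y, continuous (fun z => u z * u z) y).
  { intros u Hu y. apply (continuous_mult u u y); apply Hu. }
  assert (HE : f x * f x + g x * g x = 0).
  { apply (zero_spreads (fun y => f y * f y + g y * g y)
      (fun y => 2 * f y * (a y * f y + b y * g y)
                + 2 * g y * (c y * f y + d y * g y))
      (fun y => 2 + (a y * a y + b y * b y + (c y * c y + d y * d y))) x0).
    - intros y. specialize (Hf y). specialize (Hg y).
      auto_derive; [repeat split; eexists; eassumption|].
      rewrite (derive_value (fun z => f z) y _ Hf), (derive_value (fun z => g z) y _ Hg).
      ring.
    - intros y. apply (continuous_plus (fun _ => 2)); [apply continuous_const|].
      apply (continuous_plus (fun y => a y * a y + b y * b y)).
      + apply (continuous_plus (fun y => a y * a y)); now apply Hsq.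
      + apply (continuous_plus (fun y => c y * c y)); now apply Hsq.
    - intros y. nra.
    - intros y. set (F := f y). set (G := g y). apply Rabs_le.
      set (A := a y). set (B := b y). set (C := c y). set (D := d y).
      assert (forall t u v : R,
        - (t * t * (u * u) + v * v) <= 2 * t * u * v <= t * t * (u * u) + v * v).
      { intros t u v. pose proof (Rle_0_sqr (t * u - v)) as H1.
        pose proof (Rle_0_sqr (t * u + v)) as H2. unfold Rsqr in *. lra. }
      pose proof (H A F F). pose proof (H B F G).
      pose proof (H C G F). pose proof (H D G G).
      assert (0 <= A * A) by nra. assert (0 <= B * B) by nra.
      assert (0 <= C * C) by nra. assert (0 <= D * D) by nra.
      assert (0 <= F * F) by nra. assert (0 <= G * G) by nra.
      assert (0 <= A * A * (G * G)) by nra. assert (0 <= B * B * (G * G)) by nra.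
      assert (0 <= C * C * (F * F)) by nra. assert (0 <= D * D * (F * F)) by nra.
      lra.
    - rewrite Hf0, Hg0. ring. }
  nra.
Qed.

(** For [h = - f * g] one finds [h' = (a + d) h + b g^2 + c f^2], so up to an
    integrating factor [h] is strictly increasing.  Hence once [f] and [g] have
    the same sign in the weak sense, they had strictly the same sign at all
    earlier times. *)
Lemma competitive_product_before (f g a b c d : R -> R) (x0 : R) :
  (forall x, is_derive f x (a x * f x - b x * g x)) ->
  (forall x, is_derive g x (d x * g x - c x * f x)) ->
  (forall x, continuous a x) -> (forall x, continuous d x) ->
  (forall x, 0 < b x) -> (forall x, 0 < c x) ->
  (forall x, f x <> 0 \/ g x <> 0) ->
  0 <= f x0 * g x0 -> forall x, x < x0 -> 0 < f x * g x.
Proof.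
  intros Hf Hg Ha Hd Hb Hc Hne H0 x Hx.
  apply Ropp_lt_cancel. rewrite Ropp_0.
  apply (negative_before (fun y => - (f y * g y))
    (fun y => - ((a y * f y - b y * g y) * g y + f y * (d y * g y - c y * f y)))
    (fun y => - (a y + d y)) x0); [| | |lra|exact Hx].
  - intros y. specialize (Hf y). specialize (Hg y).
    auto_derive; [repeat split; eexists; eassumption|].
    rewrite (derive_value (fun z => f z) y _ Hf), (derive_value (fun z => g z) y _ Hg).
    ring.
  - intros y. apply (continuous_opp (fun z => a z + d z)).
    now apply (continuous_plus a d).
  - intros y. specialize (Hb y). specialize (Hc y).
    match goal with |- 0 < ?e =>
      replace e with (b y * (g y * g y) + c y * (f y * f y)) by ring end.
    assert (0 <= f y * f y) by nra. assert (0 <= g y * g y) by nra.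
    destruct (Hne y) as [Hy|Hy].
    + assert (0 < f y * f y) by nra. nra.
    + assert (0 < g y * g y) by nra. nra.
Qed.

Lemma same_sign (f : R -> R) (x y : R) :
  (forall z, continuity_pt f z) ->
  (forall z, Rmin x y <= z <= Rmax x y -> f z <> 0) -> 0 < f x * f y.
Proof.
  intros Hc Hne. apply Rnot_le_lt; intros Hle.
  destruct (IVT_gen f x y 0 Hc) as [z [Hz Hz0]]; [|now apply (Hne z)].
  unfold Rmin, Rmax. destruct Rle_dec; nra.
Qed.

(** * Shock relations and reduction to a planar system *)

(** The momentum equation of a profile, integrated from the left state, with
    the velocity eliminated by [u - um = - s (v - vm)]: it equals the viscous
    stress [eps * U' / V], and it vanishes on the Rayleigh line. *)
Definition momentum_defect (Rg vm thm s v th : R) : R :=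
  pressure Rg v th - pressure Rg vm thm + s ^ 2 * (v - vm).

(** The same for the energy equation, after subtraction of [u] times the
    momentum equation: the heat flux is [- s * energy_defect]. *)
Definition energy_defect (Rg gam vm thm s v th : R) : R :=
  Rg * (th - thm) / (gam - 1) + pressure Rg vm thm * (v - vm)
  - s ^ 2 / 2 * (v - vm) ^ 2.

(** The consequences of the jump and Lax conditions in which the velocity no
    longer appears.  [jump_speed] is the form of the energy jump that makes
    every later estimate explicit in the strength [s^2 (vp - vm)]. *)
Record shock_jump (Rg gam vm thm vp thp s : R) : Prop := {
  jump_Rg_pos : 0 < Rg;
  jump_gam_gt1 : 1 < gam;
  jump_vm_pos : 0 < vm;
  jump_thm_pos : 0 < thm;
  jump_thp_pos : 0 < thp;
  jump_s_pos : 0 < s;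
  jump_compressive : vm < vp;
  jump_pressure :
    pressure Rg vm thm = pressure Rg vp thp + s ^ 2 * (vp - vm);
  jump_speed :
    s ^ 2 * vp = gam * pressure Rg vp thp + (gam + 1) / 2 * (s ^ 2 * (vp - vm))
}.

(** A heteroclinic orbit of the two first-order equations for volume and
    temperature.  The velocity and the two conservative second-order equations
    have been integrated once. *)
Record planar_profile
    (Rg gam eps kap vm thm vp s : R) (V Th : R -> R) : Prop := {
  planar_V_pos : forall xi, 0 < V xi;
  planar_Th_pos : forall xi, 0 < Th xi;
  planar_V : forall xi, is_derive V xi
    (- (V xi * momentum_defect Rg vm thm s (V xi) (Th xi)) / (eps * s));
  planar_Th : forall xi, is_derive Th xi
    (- (s * V xi * energy_defect Rg gam vm thm s (V xi) (Th xi)) / kap);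
  planar_V_left : is_lim V m_infty vm;
  planar_Th_left : is_lim Th m_infty thm;
  planar_V_right : is_lim V p_infty vp
}.

Lemma pressure_pos (Rg v th : R) :
  0 < Rg -> 0 < v -> 0 < th -> 0 < pressure Rg v th.
Proof.
  intros. unfold pressure. apply Rdiv_lt_0_compat; [|assumption].
  now apply Rmult_lt_0_compat.
Qed.

Lemma shock_jump_pressure_pos (Rg gam vm thm vp thp s : R) :
  shock_jump Rg gam vm thm vp thp s -> 0 < pressure Rg vp thp.
Proof. intros [HR _ Hvm _ Hthp _ Hcomp _ _]. apply pressure_pos; lra. Qed.

(** The energy jump condition factors as [(vp - vm)] times [jump_speed].
    The Lax condition excludes the trivial root [vp = vm], and its inequality at
    the right state gives [gam * pp < s^2 vp], which fixes the sign of
    [vp - vm]. *)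
Lemma shock_jump_of_3shock (Rg gam vm um thm vp up thp s : R) :
  0 < Rg -> 1 < gam -> 0 < vm -> 0 < thm -> 0 < vp -> 0 < thp ->
  is_3shock Rg gam vm um thm vp up thp s ->
  shock_jump Rg gam vm thm vp thp s.
Proof.
  intros HR Hg Hvm Hthm Hvp Hthp [Hmass Hmom Hen [Hlp Hlm]].
  assert (Hs : 0 < s).
  { apply Rlt_trans with (2 := Hlp). unfold lambda3.
    apply Rdiv_lt_0_compat; [|exact Hvp].
    apply sqrt_lt_R0. repeat apply Rmult_lt_0_compat; lra. }
  set (pp := pressure Rg vp thp) in *. set (pm := pressure Rg vm thm) in *.
  assert (Hup : up = um - s * (vp - vm)) by lra.
  assert (Hpm : pm = pp + s ^ 2 * (vp - vm)) by (rewrite Hup in Hmom; lra).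
  assert (Hpv : Rg * thp = pp * vp) by (unfold pp, pressure; field; lra).
  assert (Hmv : Rg * thm = pm * vm) by (unfold pm, pressure; field; lra).
  assert (Hsup : gam * pp < s ^ 2 * vp).
  { assert (Hsq : sqrt (gam * Rg * thp) < s * vp).
    { unfold lambda3 in Hlp. apply Rlt_div_l in Hlp; [lra|exact Hvp]. }
    assert (Hpos : 0 <= gam * Rg * thp).
    { repeat apply Rmult_le_pos; lra. }
    pose proof (sqrt_sqrt _ Hpos) as Hss. pose proof (sqrt_pos (gam * Rg * thp)).
    apply (Rmult_lt_reg_r vp); [exact Hvp|].
    replace (gam * pp * vp) with (gam * Rg * thp) by (rewrite Rmult_assoc, Hpv; ring).
    nra. }
  assert (Hd : vp - vm <> 0).
  { intros Hd. assert (Hv : vp = vm) by lra.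
    assert (Hp : pm = pp) by (rewrite Hpm, Hd; ring).
    assert (Hth : thp = thm).
    { apply (Rmult_eq_reg_l Rg); [|lra]. rewrite Hpv, Hmv, Hp, Hv. ring. }
    rewrite Hth, Hv in Hlp. lra. }
  assert (Hspeed : s ^ 2 * vp = gam * pp + (gam + 1) / 2 * (s ^ 2 * (vp - vm))).
  { unfold energy in Hen. rewrite Hpv, Hmv, Hup, Hpm in Hen.
    apply (Rmult_eq_reg_l (s * (vp - vm) / (gam - 1))).
    - apply Rminus_diag_uniq. rewrite <- Hen. field. lra.
    - apply Rmult_integral_contrapositive_currified; [|apply Rinv_neq_0_compat; lra].
      apply Rmult_integral_contrapositive_currified; lra. }
  constructor; try assumption.
  assert (0 < (gam + 1) / 2 * (s ^ 2 * (vp - vm))) by lra.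
  assert (0 < s ^ 2) by nra.
  apply Rnot_le_lt; intros Hle.
  assert (s ^ 2 * (vp - vm) <= 0) by nra. nra.
Qed.

Lemma smooth_is_derive (f : R -> R) :
  smooth f -> forall x, is_derive f x (Derive f x).
Proof. intros Hf x. apply (Derive_correct f x), (Hf 1%nat x). Qed.

Lemma smooth_is_derive_2 (f : R -> R) :
  smooth f -> forall x, is_derive (Derive f) x (Derive (Derive f) x).
Proof. intros Hf x. apply (Derive_correct (Derive f) x), (Hf 2%nat x). Qed.

(** Mass, momentum and energy are integrated in turn; each constant is read off
    at minus infinity by [flux_vanishes]. *)
Lemma planar_profile_of_viscous_shock
    (Rg gam eps kap vm um thm vp up thp s : R) (V U Th : R -> R) :
  0 < eps -> 0 < kap -> shock_jump Rg gam vm thm vp thp s ->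
  is_viscous_3shock Rg gam eps kap vm um thm vp up thp s V U Th ->
  planar_profile Rg gam eps kap vm thm vp s V Th.
Proof.
  intros Heps Hkap [HR Hg Hvm Hthm Hthp Hs Hcomp _ _]
    [SV SU STh HV HTh Hmass Hmom Hen LV LU LTh RV _ _].
  pose proof (smooth_is_derive V SV) as DV.
  pose proof (smooth_is_derive U SU) as DU.
  pose proof (smooth_is_derive Th STh) as DTh.
  pose proof (smooth_is_derive_2 U SU) as DU2.
  pose proof (smooth_is_derive_2 Th STh) as DTh2.
  set (pm := pressure Rg vm thm).
  set (P := fun y => pressure Rg (V y) (Th y)).
  assert (HVne : forall x, V x <> 0) by (intros x; pose proof (HV x); lra).
  assert (DP : forall x, is_derive P x (Derive P x)).
  { intros x. apply (Derive_correct P x). unfold P, pressure. auto_derive.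
    repeat split; [eexists; apply DTh|eexists; apply DV|apply HVne]. }
  assert (DQ : forall x, is_derive (fun y => Derive U y / V y) x
                           (Derive (fun y => Derive U y / V y) x)).
  { intros x. apply (Derive_correct (fun y => Derive U y / V y) x). auto_derive.
    repeat split; [eexists; apply DU2|eexists; apply DV|apply HVne]. }
  assert (DK : forall x, is_derive (fun y => Derive Th y / V y) x
                           (Derive (fun y => Derive Th y / V y) x)).
  { intros x. apply (Derive_correct (fun y => Derive Th y / V y) x). auto_derive.
    repeat split; [eexists; apply DTh2|eexists; apply DV|apply HVne]. }
  assert (LP : is_lim P m_infty pm).
  { unfold P, pm, pressure. apply is_lim_div_R; [|exact LV|lra].
    apply (is_lim_mult_R (fun _ => Rg)); [apply is_lim_const|exact LTh]. }
  assert (HU : forall x, U x = um - s * (V x - vm)).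
  { intros x.
    assert (Hc : forall a b, s * V a + U a = s * V b + U b).
    { apply (constant_of_derive (fun y => s * V y + U y)). intros y.
      auto_derive; [repeat split; [eexists; apply DV|eexists; apply DU]|].
      rewrite (derive_value (fun z => V z) y _ (DV y)),
        (derive_value (fun z => U z) y _ (DU y)).
      pose proof (Hmass y). lra. }
    assert (Hl : is_lim (fun y => s * V y + U y) m_infty (s * vm + um)).
    { apply is_lim_plus'; [|exact LU].
      apply (is_lim_mult_R (fun _ => s)); [apply is_lim_const|exact LV]. }
    pose proof (eq_of_constant_lim _ _ Hc Hl x) as Hx. simpl in Hx. lra. }
  assert (HQ : forall x, eps * (Derive U x / V x) = - s * (U x - um) + (P x - pm)).
  { set (G := fun y => - s * U y + P y).
    assert (Hc : forall a b, G a - eps * (Derive U a / V a)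
                             = G b - eps * (Derive U b / V b)).
    { apply (constant_of_derive (fun y => G y - eps * (Derive U y / V y))).
      intros y. unfold G.
      evar_last.
      - apply (is_derive_minus (fun y => - s * U y + P y)).
        + apply (is_derive_plus (fun y => - s * U y)); [|apply DP].
          apply (is_derive_scal U y (- s) _ (DU y)).
        + apply (is_derive_scal _ y eps _ (DQ y)).
      - pose proof (Hmom y) as Hy. fold P in Hy.
        unfold minus, plus, opp; simpl. lra. }
    assert (LG : is_lim G m_infty (- s * um + pm)).
    { apply is_lim_plus'; [|exact LP].
      apply (is_lim_mult_R (fun _ => - s)); [apply is_lim_const|exact LU]. }
    set (c := G 0 - eps * (Derive U 0 / V 0)) in *.
    assert (Hq : forall x, Derive U x / V x = (G x - c) / eps).
    { intros x. unfold c. rewrite (Hc 0 x). field. split; [apply HVne|lra]. }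
    assert (Lq : is_lim (fun x => Derive U x / V x) m_infty ((- s * um + pm - c) / eps)).
    { apply (is_lim_ext (fun x => (G x - c) / eps)); [intros x; symmetry; apply Hq|].
      apply is_lim_div_R; [|apply is_lim_const|lra].
      apply is_lim_minus'; [exact LG|apply is_lim_const]. }
    pose proof (flux_vanishes U (Derive U) V _ _ _ DU HV LU LV Lq) as H0.
    assert (Hcval : c = - s * um + pm).
    { apply Rmult_integral in H0. destruct H0 as [H0|H0]; [|lra].
      apply (f_equal (fun z => z * eps)) in H0. unfold Rdiv in H0.
      rewrite Rmult_assoc, Rinv_l in H0 by lra. lra. }
    intros x. rewrite Hq, Hcval. unfold G. field. lra. }
  assert (HT : forall x, kap * (Derive Th x / V x)
     = - s * energy_defect Rg gam vm thm s (V x) (Th x)).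
  { set (E := fun y => energy Rg gam (U y) (Th y)).
    set (G := fun y => - s * E y + P y * U y - eps * (Derive U y / V y * U y)).
    assert (DE : forall x, is_derive E x (Derive E x)).
    { intros x. apply (Derive_correct E x). unfold E, energy. auto_derive.
      repeat split; [eexists; apply DTh|eexists; apply DU]. }
    assert (DPU : forall x, is_derive (fun y => P y * U y) x
                   (Derive (fun y => P y * U y) x)).
    { intros x. apply (Derive_correct (fun y => P y * U y) x). auto_derive.
      repeat split; eexists; [apply DP|apply DU]. }
    assert (DQU : forall x, is_derive (fun y => Derive U y / V y * U y) x
                   (Derive (fun y => Derive U y * U y / V y) x)).
    { intros x.
      rewrite (Derive_ext (fun y => Derive U y * U y / V y)
                 (fun y => Derive U y / V y * U y)) by (intros y; field; apply HVne).
      apply (Derive_correct (fun y => Derive U y / V y * U y) x). auto_derive.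
      repeat split; [eexists; apply DU2|eexists; apply DV|apply HVne|eexists; apply DU]. }
    assert (Hc : forall a b, G a - kap * (Derive Th a / V a)
                             = G b - kap * (Derive Th b / V b)).
    { apply (constant_of_derive (fun y => G y - kap * (Derive Th y / V y))).
      intros y. unfold G.
      evar_last.
      - apply (is_derive_minus
                 (fun y => - s * E y + P y * U y - eps * (Derive U y / V y * U y))).
        + apply (is_derive_minus (fun y => - s * E y + P y * U y)).
          * apply (is_derive_plus (fun y => - s * E y)); [|apply DPU].
            apply (is_derive_scal E y (- s) _ (DE y)).
          * apply (is_derive_scal _ y eps _ (DQU y)).
        + apply (is_derive_scal _ y kap _ (DK y)).
      - pose proof (Hen y) as Hy. fold E in Hy.
        change (fun y => pressure Rg (V y) (Th y) * U y) with (fun y => P y * U y) in Hy.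
        unfold minus, plus, opp; simpl. lra. }
    set (GG := fun y => - s * energy_defect Rg gam vm thm s (V y) (Th y)).
    (* The integrated energy law minus U times the integrated momentum law. *)
    assert (HG : forall y, G y - G 0 = GG y - GG 0).
    { assert (HGy : forall y, G y = GG y
         + (- s * energy Rg gam um thm + pm * um)).
      { intros y. unfold G, GG, E, energy, energy_defect. fold pm.
        replace (eps * (Derive U y / V y * U y))
          with (eps * (Derive U y / V y) * U y) by ring.
        rewrite HQ, HU. field. lra. }
      intros y. rewrite !HGy. ring. }
    set (c := GG 0 - kap * (Derive Th 0 / V 0)) in *.
    assert (Hq : forall x, Derive Th x / V x = (GG x - c) / kap).
    { intros x. pose proof (Hc 0 x). pose proof (HG x).
      apply (Rmult_eq_reg_l kap); [|lra].
      replace (kap * ((GG x - c) / kap)) with (GG x - c) by (field; lra).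
      unfold c. lra. }
    assert (LGG : is_lim GG m_infty 0).
    { replace 0 with (- s * energy_defect Rg gam vm thm s vm thm)
        by (unfold energy_defect; field; lra).
      unfold GG, energy_defect.
      apply (is_lim_mult_R (fun _ => - s)); [apply is_lim_const|].
      apply is_lim_minus'; [apply is_lim_plus'|].
      - apply is_lim_div_R; [|apply is_lim_const|lra].
        apply (is_lim_mult_R (fun _ => Rg)); [apply is_lim_const|].
        apply is_lim_minus'; [exact LTh|apply is_lim_const].
      - apply (is_lim_mult_R (fun _ => pressure Rg vm thm)); [apply is_lim_const|].
        apply is_lim_minus'; [exact LV|apply is_lim_const].
      - apply (is_lim_mult_R (fun _ => s ^ 2 / 2)); [apply is_lim_const|].
        assert (LVm : is_lim (fun y => V y - vm) m_infty (vm - vm))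
          by (apply is_lim_minus'; [exact LV|apply is_lim_const]).
        simpl. apply is_lim_mult_R; [exact LVm|].
        apply (is_lim_mult_R (fun y => V y - vm) (fun _ => 1));
          [exact LVm|apply is_lim_const]. }
    assert (Lq : is_lim (fun x => Derive Th x / V x) m_infty ((0 - c) / kap)).
    { apply (is_lim_ext (fun x => (GG x - c) / kap)); [intros x; symmetry; apply Hq|].
      apply is_lim_div_R; [|apply is_lim_const|lra].
      apply is_lim_minus'; [exact LGG|apply is_lim_const]. }
    pose proof (flux_vanishes Th (Derive Th) V _ _ _ DTh HV LTh LV Lq) as H0.
    assert (Hcval : c = 0).
    { apply Rmult_integral in H0. destruct H0 as [H0|H0]; [|lra].
      apply (f_equal (fun z => z * kap)) in H0. unfold Rdiv in H0.
      rewrite Rmult_assoc, Rinv_l in H0 by lra. lra. }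
    intros x. rewrite Hq, Hcval. unfold GG. field. lra. }
  constructor; try assumption.
  - intros x. evar_last; [apply DV|].
    assert (HdU : Derive U x = - s * Derive V x) by (pose proof (Hmass x); lra).
    specialize (HQ x). rewrite HdU, HU in HQ. unfold momentum_defect.
    fold pm. change (pressure Rg (V x) (Th x)) with (P x).
    replace (P x - pm + s ^ 2 * (V x - vm))
      with (- s * (um - s * (V x - vm) - um) + (P x - pm)) by ring.
    rewrite <- HQ. field. repeat split; try lra. apply HVne.
  - intros x. evar_last; [apply DTh|].
    replace (- (s * V x * energy_defect Rg gam vm thm s (V x) (Th x)) / kap)
      with (V x * (- s * energy_defect Rg gam vm thm s (V x) (Th x)) / kap)
      by (field; lra).
    rewrite <- HT. field. split; [apply HVne|lra].
Qed.

(** * The profile stays between the Rayleigh line and the energy curve *)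

(** On the Rayleigh line the energy defect is a multiple of
    [(v - vm) (vp - v)], because both end states are rest points; off the line
    it is corrected by the momentum defect.  So opposite signs of the two
    defects already force [v] to lie between [vm] and [vp]. *)
Lemma energy_defect_split (Rg gam vm thm vp thp s v th : R) :
  shock_jump Rg gam vm thm vp thp s -> v <> 0 ->
  (gam - 1) * energy_defect Rg gam vm thm s v th
  = v * momentum_defect Rg vm thm s v th
    + (gam + 1) / 2 * s ^ 2 * ((v - vm) * (vp - v)).
Proof.
  intros [HR Hg Hvm Hthm Hthp Hs Hcomp Hp Hsp] Hv.
  unfold energy_defect, momentum_defect.
  replace (Rg * (th - thm) / (gam - 1))
    with ((pressure Rg v th * v - pressure Rg vm thm * vm) / (gam - 1))
    by (unfold pressure; field; lra).
  set (P := pressure Rg v th). set (pm := pressure Rg vm thm) in *.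
  set (pp := pressure Rg vp thp) in *.
  apply Rminus_diag_uniq.
  transitivity ((v - vm) * (gam * pm - s ^ 2 * vm - (gam + 1) / 2 * (s ^ 2 * (vp - vm)))).
  - field. lra.
  - replace (s ^ 2 * vm) with (s ^ 2 * vp - s ^ 2 * (vp - vm)) by ring.
    rewrite Hsp, Hp. field.
Qed.

(** Along a profile the two defects satisfy a linear system, whose coefficients
    depend on the profile; both coupling coefficients are negative as soon as
    the Rayleigh pressure [pm - s^2 (V - vm)] is positive. *)
Lemma is_derive_momentum_defect
    (Rg gam eps kap vm thm vp s : R) (V Th : R -> R) :
  0 < eps -> 0 < kap -> 0 < s ->
  planar_profile Rg gam eps kap vm thm vp s V Th ->
  forall x, is_derive (fun y => momentum_defect Rg vm thm s (V y) (Th y)) x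
    (- (s ^ 2 * V x - pressure Rg (V x) (Th x)) / (eps * s)
       * momentum_defect Rg vm thm s (V x) (Th x)
     - Rg * s / kap * energy_defect Rg gam vm thm s (V x) (Th x)).
Proof.
  intros He Hk Hs [HV _ DV DTh _ _ _] x.
  specialize (DV x). specialize (DTh x). pose proof (HV x) as HVx.
  set (F1 := momentum_defect Rg vm thm s (V x) (Th x)) in *.
  set (F2 := energy_defect Rg gam vm thm s (V x) (Th x)) in *.
  unfold momentum_defect, pressure. auto_derive.
  - repeat split; [eexists; exact DTh|eexists; exact DV|lra|eexists; exact DV].
  - rewrite (derive_value (fun z => V z) x _ DV), (derive_value (fun z => Th z) x _ DTh).
    field. lra.
Qed.

Lemma is_derive_energy_defect
    (Rg gam eps kap vm thm vp s : R) (V Th : R -> R) :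
  1 < gam -> 0 < eps -> 0 < kap -> 0 < s ->
  planar_profile Rg gam eps kap vm thm vp s V Th ->
  forall x, is_derive (fun y => energy_defect Rg gam vm thm s (V y) (Th y)) x
    (- (Rg * s * V x / (kap * (gam - 1)))
       * energy_defect Rg gam vm thm s (V x) (Th x)
     - (pressure Rg vm thm - s ^ 2 * (V x - vm)) * V x / (eps * s)
       * momentum_defect Rg vm thm s (V x) (Th x)).
Proof.
  intros Hg He Hk Hs [HV _ DV DTh _ _ _] x.
  specialize (DV x). specialize (DTh x). pose proof (HV x) as HVx.
  set (F1 := momentum_defect Rg vm thm s (V x) (Th x)) in *.
  set (F2 := energy_defect Rg gam vm thm s (V x) (Th x)) in *.
  unfold energy_defect. set (pm := pressure Rg vm thm). auto_derive.
  - repeat split; [eexists; exact DTh|eexists; exact DV|eexists; exact DV].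
  - rewrite (derive_value (fun z => V z) x _ DV), (derive_value (fun z => Th z) x _ DTh).
    field. lra.
Qed.

(** The volume equation says that the derivative of the Rayleigh pressure is
    [s V / eps] times (gas pressure minus Rayleigh pressure).  It is relaxed
    towards something positive, and it starts near [pm > 0]. *)
Lemma rayleigh_pressure_pos (Rg gam eps kap vm thm vp thp s : R) (V Th : R -> R) :
  0 < eps -> 0 < kap -> shock_jump Rg gam vm thm vp thp s ->
  planar_profile Rg gam eps kap vm thm vp s V Th ->
  forall x, 0 < pressure Rg vm thm - s ^ 2 * (V x - vm).
Proof.
  intros He Hk [HR Hg Hvm Hthm Hthp Hs Hcomp _ _] [HV HTh DV _ LV _ _] x.
  pose proof (pressure_pos Rg vm thm HR Hvm Hthm) as Hpm.
  set (pm := pressure Rg vm thm) in *.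
  assert (Hs2 : 0 < s ^ 2) by nra.
  destruct (is_lim_m_infty_near V vm (pm / s ^ 2) x LV) as [a [Ha Hnear]].
  { now apply Rdiv_lt_0_compat. }
  apply (positive_persists (fun y => pm - s ^ 2 * (V y - vm))
    (fun y => s / eps * (V y * momentum_defect Rg vm thm s (V y) (Th y)))
    (fun y => s / eps * V y) a); [| | | |exact Ha].
  - intros y. specialize (DV y).
    auto_derive; [eexists; exact DV|].
    rewrite (derive_value (fun z => V z) y _ DV). field. lra.
  - intros y. apply (continuous_mult (fun _ => s / eps) V); [apply continuous_const|].
    apply (ex_derive_continuous V y). eexists; apply DV.
  - intros y. unfold momentum_defect. fold pm.
    pose proof (pressure_pos Rg (V y) (Th y) HR (HV y) (HTh y)) as HP.
    match goal with |- 0 <= ?e =>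
      replace e with (s / eps * (V y * pressure Rg (V y) (Th y))) by ring end.
    pose proof (HV y). apply Rlt_le.
    apply Rmult_lt_0_compat; [now apply Rdiv_lt_0_compat|].
    now apply Rmult_lt_0_compat.
  - apply Rabs_lt_between in Hnear.
    assert (Hlt : (V a - vm) * s ^ 2 < pm).
    { apply Rlt_div_r; [exact Hs2|lra]. }
    lra.
Qed.

(** If both defects had the same sign at some time, they would have had
    strictly the same sign ever before, by [competitive_product_before].  Then
    volume and temperature would both be monotone, in the same direction, from
    the left state up to that time, which contradicts the sign of the energy
    defect.  So the signs are opposite throughout; the volume is then monotone,
    and it has to increase from [vm] to [vp]. *)
Lemma shock_profile_region (Rg gam eps kap vm thm vp thp s : R) (V Th : R -> R) :
  0 < eps -> 0 < kap -> shock_jump Rg gam vm thm vp thp s ->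
  planar_profile Rg gam eps kap vm thm vp s V Th ->
  forall x, momentum_defect Rg vm thm s (V x) (Th x) < 0 /\
            0 < energy_defect Rg gam vm thm s (V x) (Th x) /\
            vm < V x < vp.
Proof.
  intros He Hk Hj Hprof.
  pose proof (rayleigh_pressure_pos _ _ _ _ _ _ _ _ _ _ _ He Hk Hj Hprof) as Hpi.
  pose proof Hj as [HR Hg Hvm Hthm Hthp Hs Hcomp _ _].
  pose proof (is_derive_momentum_defect _ _ _ _ _ _ _ _ _ _ He Hk Hs Hprof) as D1.
  pose proof (is_derive_energy_defect _ _ _ _ _ _ _ _ _ _ Hg He Hk Hs Hprof) as D2.
  pose proof Hprof as [HV HTh DV DTh LV LTh RV].
  set (F1 := fun y => momentum_defect Rg vm thm s (V y) (Th y)).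
  set (F2 := fun y => energy_defect Rg gam vm thm s (V y) (Th y)).
  set (pm := pressure Rg vm thm) in *.
  set (a := fun y => - (s ^ 2 * V y - pressure Rg (V y) (Th y)) / (eps * s)).
  set (b := fun _ : R => Rg * s / kap).
  set (c := fun y => (pm - s ^ 2 * (V y - vm)) * V y / (eps * s)).
  set (d := fun y => - (Rg * s * V y / (kap * (gam - 1)))).
  assert (EV : forall y, ex_derive V y) by (intros y; eexists; apply DV).
  assert (ETh : forall y, ex_derive Th y) by (intros y; eexists; apply DTh).
  assert (Ca : forall y, continuous a y).
  { intros y. apply (ex_derive_continuous a y). unfold a, pressure. auto_derive.
    pose proof (HV y). repeat split; auto; lra. }
  assert (Cb : forall y, continuous b y) by (intros y; apply continuous_const).
  assert (Cc : forall y, continuous c y).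
  { intros y. apply (ex_derive_continuous c y). unfold c. auto_derive.
    repeat split; auto. }
  assert (Cd : forall y, continuous d y).
  { intros y. apply (ex_derive_continuous d y). unfold d. auto_derive.
    repeat split; auto. }
  assert (Hes : 0 < eps * s) by now apply Rmult_lt_0_compat.
  assert (Hb : forall y, 0 < b y).
  { intros y. unfold b. apply Rdiv_lt_0_compat; [now apply Rmult_lt_0_compat|exact Hk]. }
  assert (Hc : forall y, 0 < c y).
  { intros y. unfold c. apply Rdiv_lt_0_compat; [|exact Hes].
    apply Rmult_lt_0_compat; [apply Hpi|apply HV]. }
  (* A common zero of the defects would make the profile constant. *)
  assert (Hne : forall y, F1 y <> 0 \/ F2 y <> 0).
  { intros y. destruct (Req_dec (F1 y) 0) as [H1|H1]; [|now left].
    right. intros H2.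
    assert (HF1 : forall z, F1 z = 0).
    { apply (linear_system_zero F1 F2 a (fun z => - b z) (fun z => - c z) d y);
        try assumption.
      - intros z. evar_last; [apply D1|]. unfold F1, F2, a, b. ring.
      - intros z. evar_last; [apply D2|]. unfold F1, F2, c, d. ring.
      - intros z. now apply (continuous_opp b).
      - intros z. now apply (continuous_opp c). }
    assert (HVc : forall z w, V z = V w).
    { apply constant_of_derive. intros z. evar_last; [apply DV|].
      change (momentum_defect Rg vm thm s (V z) (Th z)) with (F1 z).
      rewrite HF1. field. lra. }
    pose proof (eq_of_constant_lim V vm HVc LV) as HVm.
    apply (is_lim_ext V (fun _ => vm) p_infty) in RV; [|exact HVm].
    apply is_lim_unique in RV. rewrite Lim_const in RV. injection RV. lra. }
  assert (C1 : forall y, continuity_pt F1 y).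
  { intros y. exact (is_derive_continuity_pt F1 y _ (D1 y)). }
  assert (V_nonincr : forall y, (forall z, z <= y -> 0 < F1 z) -> V y <= vm).
  { intros y Hy. refine (nonincreasing_le_lim V _ vm y DV _ LV).
    intros z Hz. specialize (Hy z Hz). pose proof (HV z).
    apply Rlt_le, Rdiv_neg_pos; [|exact Hes].
    change (momentum_defect Rg vm thm s (V z) (Th z)) with (F1 z). nra. }
  assert (Hopp : forall y, F1 y * F2 y < 0).
  { intros y. apply Rnot_le_lt. intros Hy.
    assert (Hbefore : forall z, z < y -> 0 < F1 z * F2 z).
    { apply (competitive_product_before F1 F2 a b c d y); assumption. }
    set (x1 := y - 1).
    assert (Hsame : forall z, z <= x1 -> 0 < F1 z * F1 x1).
    { intros z Hz. apply same_sign; [exact C1|]. intros w Hw Hw0.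
      rewrite Rmin_left, Rmax_right in Hw by exact Hz.
      assert (0 < F1 w * F2 w) by (apply Hbefore; unfold x1 in Hw; lra). nra. }
    assert (Hx1 : 0 < F1 x1 * F2 x1) by (apply Hbefore; unfold x1; lra).
    assert (HF2 : F2 x1 = Rg / (gam - 1) * (Th x1 - thm)
                   + (V x1 - vm) * (pm - s ^ 2 / 2 * (V x1 - vm))).
    { unfold F2, energy_defect. fold pm. field. lra. }
    assert (Hcoef : 0 < Rg / (gam - 1)) by (apply Rdiv_lt_0_compat; lra).
    assert (Hpm : 0 < pm) by now apply pressure_pos.
    destruct (Rlt_or_le 0 (F1 x1)) as [Hpos|Hneg].
    - assert (HVx : V x1 <= vm).
      { apply V_nonincr. intros z Hz. specialize (Hsame z Hz). nra. }
      assert (HTx : Th x1 <= thm).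
      { refine (nonincreasing_le_lim Th _ thm x1 DTh _ LTh).
        intros z Hz. specialize (Hsame z Hz).
        assert (HF1z : 0 < F1 z) by nra.
        assert (HF12 : 0 < F1 z * F2 z) by (apply Hbefore; unfold x1 in Hz; lra).
        assert (HF2z : 0 < F2 z) by nra.
        apply Rlt_le, Rdiv_neg_pos; [|exact Hk].
        change (energy_defect Rg gam vm thm s (V z) (Th z)) with (F2 z).
        pose proof (Rmult_lt_0_compat s (V z) Hs (HV z)). nra. }
      assert (HF2x : 0 < F2 x1) by nra.
      assert (0 < pm - s ^ 2 / 2 * (V x1 - vm)) by nra.
      assert (Rg / (gam - 1) * (Th x1 - thm) <= 0) by nra.
      nra.
    - assert (Hneg' : F1 x1 < 0).
      { destruct Hneg as [Hneg|Heq]; [exact Hneg|]. rewrite Heq in Hx1. lra. }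
      assert (HVx : vm <= V x1).
      { refine (nondecreasing_ge_lim V _ vm x1 DV _ LV).
        intros z Hz. specialize (Hsame z Hz). pose proof (HV z).
        assert (F1 z < 0) by nra.
        apply Rlt_le, Rdiv_lt_0_compat; [|exact Hes].
        change (momentum_defect Rg vm thm s (V z) (Th z)) with (F1 z). nra. }
      assert (HTx : thm <= Th x1).
      { refine (nondecreasing_ge_lim Th _ thm x1 DTh _ LTh).
        intros z Hz. specialize (Hsame z Hz).
        assert (HF1z : F1 z < 0) by nra.
        assert (HF12 : 0 < F1 z * F2 z) by (apply Hbefore; unfold x1 in Hz; lra).
        assert (HF2z : F2 z < 0) by nra.
        apply Rlt_le, Rdiv_lt_0_compat; [|exact Hk].
        change (energy_defect Rg gam vm thm s (V z) (Th z)) with (F2 z).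
        pose proof (Rmult_lt_0_compat s (V z) Hs (HV z)). nra. }
      assert (HF2x : F2 x1 < 0) by nra.
      pose proof (Hpi x1) as Hpix.
      assert (0 < pm - s ^ 2 / 2 * (V x1 - vm)) by lra.
      assert (0 <= Rg / (gam - 1) * (Th x1 - thm)) by nra.
      nra. }
  assert (HF1 : forall y, F1 y < 0).
  { intros y. apply Rnot_le_lt. intros Hy.
    assert (Hpos : forall z, 0 < F1 z).
    { intros z. assert (0 < F1 z * F1 y).
      { apply same_sign; [exact C1|]. intros w _ Hw. specialize (Hopp w).
        rewrite Hw in Hopp. lra. }
      nra. }
    assert (Rbar_le vp vm).
    { apply (is_lim_le_loc V (fun _ => vm) p_infty vp vm);
        [|exact RV|apply is_lim_const].
      exists 0. intros z _. apply V_nonincr. intros w _. apply Hpos. }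
    simpl in H. lra. }
  intros x. specialize (HF1 x). specialize (Hopp x).
  assert (HF2 : 0 < F2 x) by nra.
  split; [exact HF1|]. split; [exact HF2|].
  pose proof (HV x) as HVx.
  pose proof (energy_defect_split _ _ _ _ _ _ _ (V x) (Th x) Hj ltac:(lra)) as Hsplit.
  fold (F1 x) in Hsplit. fold (F2 x) in Hsplit.
  assert (HB : 0 < (gam + 1) / 2 * s ^ 2 * ((V x - vm) * (vp - V x))) by nra.
  assert (0 < (V x - vm) * (vp - V x)).
  { assert (0 < (gam + 1) / 2 * s ^ 2) by (apply Rmult_lt_0_compat; nra). nra. }
  split; nra.
Qed.

(** * The normalized momentum defect *)

(** The chord slopes [(V - v) / (P - p)] to the two end states differ from
    [- 1 / s^2] by terms governed by this quotient, and for weak shocks it tends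
    to the coefficient in the estimate to be proved.  The power [s^4] makes that
    limit independent of [s]. *)
Definition scaled_defect (Rg vm thm vp s v th : R) : R :=
  - momentum_defect Rg vm thm s v th / (s ^ 4 * ((v - vm) * (vp - v))).

Lemma scaled_defect_spec (Rg vm thm vp s v th : R) :
  0 < s -> vm < v < vp ->
  momentum_defect Rg vm thm s v th
  = - (scaled_defect Rg vm thm vp s v th * (s ^ 4 * ((v - vm) * (vp - v)))).
Proof. intros Hs Hv. unfold scaled_defect. field. repeat split; lra. Qed.

Lemma shock_jump_speed_left (Rg gam vm thm vp thp s : R) :
  shock_jump Rg gam vm thm vp thp s ->
  s ^ 2 * vm = gam * pressure Rg vp thp + (gam - 1) / 2 * (s ^ 2 * (vp - vm)).
Proof. intros [_ _ _ _ _ _ _ _ Hsp]. lra. Qed.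

Lemma strength_pos (s vm vp : R) : 0 < s -> vm < vp -> 0 < s ^ 2 * (vp - vm).
Proof. intros Hs Hv. apply Rmult_lt_0_compat; [apply pow_lt; exact Hs|lra]. Qed.

(** The upper bound is positivity of the energy defect, written with
    [energy_defect_split]. *)
Lemma scaled_defect_bounds (Rg gam vm thm vp thp s v th : R) :
  shock_jump Rg gam vm thm vp thp s -> vm < v < vp ->
  momentum_defect Rg vm thm s v th < 0 ->
  0 < energy_defect Rg gam vm thm s v th ->
  let psi := scaled_defect Rg vm thm vp s v th in
  0 < psi /\ psi * (s ^ 2 * v) < (gam + 1) / 2.
Proof.
  intros Hj Hv HF1 HF2 psi.
  pose proof Hj as [HR Hg Hvm Hthm Hthp Hs Hcomp Hp Hsp].
  assert (HB : 0 < (v - vm) * (vp - v)) by (apply Rmult_lt_0_compat; lra).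
  assert (Hs2 : 0 < s ^ 2) by (apply pow_lt; exact Hs).
  assert (Hs4 : 0 < s ^ 4) by (apply pow_lt; exact Hs).
  pose proof (energy_defect_split _ _ _ _ _ _ _ v th Hj ltac:(lra)) as Hsplit.
  pose proof (scaled_defect_spec Rg vm thm vp s v th Hs Hv) as Hspec.
  fold psi in Hspec.
  set (B := (v - vm) * (vp - v)) in *.
  assert (HsB : 0 < s ^ 4 * B) by now apply Rmult_lt_0_compat.
  split.
  - unfold psi, scaled_defect. apply Rdiv_lt_0_compat; [lra|exact HsB].
  - apply (Rmult_lt_reg_r (s ^ 2 * B)); [now apply Rmult_lt_0_compat|].
    rewrite Hspec in Hsplit.
    assert (0 < (gam - 1) * energy_defect Rg gam vm thm s v th)
      by (apply Rmult_lt_0_compat; lra).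
    replace (psi * (s ^ 2 * v) * (s ^ 2 * B)) with (v * (psi * (s ^ 4 * B))) by ring.
    lra.
Qed.

(** Common upper bound of the normalized defect and of its weak-shock limit. *)
Definition defect_cap (gam pp : R) : R := (gam + 1) / (2 * gam * pp).

Lemma scaled_defect_lt_cap (Rg gam vm thm vp thp s v psi : R) :
  shock_jump Rg gam vm thm vp thp s -> vm < v ->
  0 < psi -> psi * (s ^ 2 * v) < (gam + 1) / 2 ->
  psi < defect_cap gam (pressure Rg vp thp).
Proof.
  intros Hj Hv Hpsi Hlt.
  pose proof (shock_jump_pressure_pos _ _ _ _ _ _ _ Hj) as Hpp.
  pose proof (shock_jump_speed_left _ _ _ _ _ _ _ Hj) as Hsl.
  destruct Hj as [HR Hg Hvm Hthm Hthp Hs Hcomp _ _].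
  pose proof (strength_pos s vm vp Hs Hcomp).
  set (pp := pressure Rg vp thp) in *.
  assert (Hgp : 0 < gam * pp) by (apply Rmult_lt_0_compat; lra).
  assert (Hs2 : 0 < s ^ 2) by (apply pow_lt; exact Hs).
  assert (gam * pp < s ^ 2 * v) by nra.
  unfold defect_cap. apply Rlt_div_r; nra.
Qed.

(** Quantitative form of [pp < P]: the first factor is
    [(P - pp) / (s^2 (vp - v))].  It comes from
    [(v - vm) / v < (vp - vm) / vp] and
    [1 + defect_cap * strength = s^2 vp / (gam pp)],
    and holds for every strength. *)
Lemma pressure_margin (Rg gam vm thm vp thp s v psi : R) :
  shock_jump Rg gam vm thm vp thp s -> vm < v < vp ->
  0 < psi -> psi * (s ^ 2 * v) < (gam + 1) / 2 ->
  1 <= (1 - s ^ 2 * (v - vm) * psi)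
       * (1 + defect_cap gam (pressure Rg vp thp) * (s ^ 2 * (vp - vm))).
Proof.
  intros Hj Hv Hpsi Hlt.
  pose proof (shock_jump_pressure_pos _ _ _ _ _ _ _ Hj) as Hpp.
  destruct Hj as [HR Hg Hvm Hthm Hthp Hs Hcomp _ Hsp].
  set (pp := pressure Rg vp thp) in *.
  assert (Hgp : 0 < gam * pp) by (apply Rmult_lt_0_compat; lra).
  assert (Hs2 : 0 < s ^ 2) by (apply pow_lt; exact Hs).
  apply (Rmult_le_reg_l (gam * pp)); [exact Hgp|].
  replace (gam * pp * ((1 - s ^ 2 * (v - vm) * psi)
             * (1 + defect_cap gam pp * (s ^ 2 * (vp - vm)))))
    with ((1 - s ^ 2 * (v - vm) * psi)
          * (gam * pp + (gam + 1) / 2 * (s ^ 2 * (vp - vm))))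
    by (unfold defect_cap; field; lra).
  rewrite <- Hsp.
  assert (s ^ 2 * (v - vm) * psi * (s ^ 2 * vp)
          <= (gam + 1) / 2 * (s ^ 2 * (vp - vm))); [|lra].
  apply (Rmult_le_reg_r v); [lra|].
  apply Rle_trans with ((psi * (s ^ 2 * v)) * (s ^ 2 * (v * (vp - vm)))).
  - replace (s ^ 2 * (v - vm) * psi * (s ^ 2 * vp) * v)
      with ((psi * (s ^ 2 * v)) * (s ^ 2 * ((v - vm) * vp))) by ring.
    apply Rmult_le_compat_l; [apply Rmult_le_pos; nra|].
    apply Rmult_le_compat_l; nra.
  - replace ((gam + 1) / 2 * (s ^ 2 * (vp - vm)) * v)
      with ((gam + 1) / 2 * (s ^ 2 * (v * (vp - vm)))) by ring.
    apply Rmult_le_compat_r; [|lra]. apply Rmult_le_pos; nra.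
Qed.

(** Coefficient of the relaxation equation
    [eps s psi' = (gam + 1) / 2 * rho - psi * damping] of the normalized
    defect, where [rho = Rg eps / (kap (gam - 1))]. *)
Definition damping (Rg vm vp s rho psi v th : R) : R :=
  s ^ 2 * v - pressure Rg v th + rho * (s ^ 2 * v)
  + psi * (s ^ 2 * v) * (s ^ 2 * (vp + vm - 2 * v)).

(** The defect system is divided by [(V - vm) (vp - V)], with the energy defect
    eliminated by [energy_defect_split]; the last term of [damping] is the
    derivative of that product. *)
Lemma is_derive_scaled_defect (Rg gam eps kap vm thm vp thp s : R) (V Th : R -> R) :
  0 < eps -> 0 < kap -> shock_jump Rg gam vm thm vp thp s ->
  planar_profile Rg gam eps kap vm thm vp s V Th ->
  (forall x, vm < V x < vp) ->
  let rho := Rg * eps / (kap * (gam - 1)) in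
  let psi := fun y => scaled_defect Rg vm thm vp s (V y) (Th y) in
  forall x, is_derive psi x
    (((gam + 1) / 2 * rho - psi x * damping Rg vm vp s rho (psi x) (V x) (Th x))
     / (eps * s)).
Proof.
  intros He Hk Hj Hprof Hreg rho psi x.
  pose proof (is_derive_momentum_defect _ _ _ _ _ _ _ _ _ _ He Hk
                (jump_s_pos _ _ _ _ _ _ _ Hj) Hprof x) as D1.
  pose proof Hj as [HR Hg Hvm Hthm Hthp Hs Hcomp _ _].
  specialize (Hreg x).
  pose proof (planar_V _ _ _ _ _ _ _ _ _ _ Hprof x) as DV.
  pose proof (energy_defect_split _ _ _ _ _ _ _ (V x) (Th x) Hj ltac:(lra)) as Hsplit.
  pose proof (scaled_defect_spec Rg vm thm vp s (V x) (Th x) Hs Hreg) as Hspec.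
  fold (psi x) in Hspec.
  set (F1 := fun y => momentum_defect Rg vm thm s (V y) (Th y)) in *.
  fold (F1 x) in Hspec, Hsplit, D1, DV.
  set (F2 := energy_defect Rg gam vm thm s (V x) (Th x)) in *.
  assert (HF2 : F2 = (V x * F1 x + (gam + 1) / 2 * s ^ 2 * ((V x - vm) * (vp - V x)))
                     / (gam - 1)).
  { rewrite <- Hsplit. field. lra. }
  rewrite HF2, Hspec in D1. rewrite Hspec in DV.
  assert (E1 : ex_derive F1 x) by (eexists; exact D1).
  assert (EV : ex_derive V x) by (eexists; exact DV).
  change (is_derive (fun y => - F1 y / (s ^ 4 * ((V y - vm) * (vp - V y)))) x
    (((gam + 1) / 2 * rho - psi x * damping Rg vm vp s rho (psi x) (V x) (Th x))
     / (eps * s))).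
  auto_derive.
  - repeat split; try assumption.
    repeat apply Rmult_integral_contrapositive_currified; lra.
  - rewrite (derive_value (fun z => F1 z) x _ D1), (derive_value (fun z => V z) x _ DV).
    rewrite Hspec. unfold damping, rho.
    set (P := pressure Rg (V x) (Th x)). set (f := psi x). set (v := V x) in *.
    field. repeat split; lra.
Qed.

(** [jump_speed] puts [s^2 v] within a multiple of the strength of [gam * pp],
    the pressure lies between [pp] and [pp] plus the strength, and the quadratic
    term is at most [(gam + 1) / 2] times the strength. *)
Lemma damping_close (Rg gam vm thm vp thp s v th rho rho1 : R) :
  shock_jump Rg gam vm thm vp thp s -> vm < v < vp ->
  momentum_defect Rg vm thm s v th < 0 ->
  0 < energy_defect Rg gam vm thm s v th ->
  0 < rho <= rho1 ->
  let psi := scaled_defect Rg vm thm vp s v th in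
  let pp := pressure Rg vp thp in
  Rabs (damping Rg vm vp s rho psi v th - ((gam - 1) * pp + rho * (gam * pp)))
  <= (gam + 1) * (1 + rho1) * (s ^ 2 * (vp - vm)).
Proof.
  intros Hj Hv HF1 HF2 Hrho psi pp.
  pose proof (shock_jump_pressure_pos _ _ _ _ _ _ _ Hj) as Hpp.
  destruct (scaled_defect_bounds _ _ _ _ _ _ _ _ _ Hj Hv HF1 HF2) as [Hpsi Hpsiv].
  fold psi in Hpsi, Hpsiv.
  pose proof (pressure_margin _ _ _ _ _ _ _ _ _ Hj Hv Hpsi Hpsiv) as Hmargin.
  pose proof (shock_jump_speed_left _ _ _ _ _ _ _ Hj) as Hsl.
  pose proof Hj as [HR Hg Hvm Hthm Hthp Hs Hcomp Hp Hsp].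
  pose proof (strength_pos s vm vp Hs Hcomp) as Hdel.
  fold pp in Hpp, Hmargin, Hsl, Hsp, Hp.
  pose proof (scaled_defect_spec Rg vm thm vp s v th Hs Hv) as Hspec. fold psi in Hspec.
  assert (Hs2 : 0 < s ^ 2) by (apply pow_lt; exact Hs).
  assert (Hcap : 0 < defect_cap gam pp).
  { unfold defect_cap. apply Rdiv_lt_0_compat; [lra|].
    apply Rmult_lt_0_compat; lra. }
  set (del := s ^ 2 * (vp - vm)) in *.
  assert (Ha : 0 < 1 - s ^ 2 * (v - vm) * psi).
  { assert (0 < defect_cap gam pp * del) by now apply Rmult_lt_0_compat. nra. }
  set (P := pressure Rg v th).
  assert (HPu : P < pressure Rg vm thm).
  { unfold momentum_defect in HF1. fold P in HF1. nra. }
  assert (HPl : pp < P).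
  { assert (P - pp = s ^ 2 * (vp - v) * (1 - s ^ 2 * (v - vm) * psi)).
    { unfold momentum_defect in Hspec. fold P in Hspec.
      replace P with (P - pressure Rg vm thm + s ^ 2 * (v - vm)
                      + (pressure Rg vm thm - s ^ 2 * (v - vm))) by ring.
      rewrite Hspec, Hp. unfold del. ring. }
    assert (0 < s ^ 2 * (vp - v)) by (apply Rmult_lt_0_compat; lra). nra. }
  assert (Hw : 0 < s ^ 2 * v - gam * pp < (gam + 1) / 2 * del).
  { split; nra. }
  assert (Ht : Rabs (psi * (s ^ 2 * v) * (s ^ 2 * (vp + vm - 2 * v)))
               <= (gam + 1) / 2 * del).
  { rewrite Rabs_mult. apply Rmult_le_compat; try apply Rabs_pos.
    - rewrite Rabs_right; [lra|]. apply Rle_ge, Rmult_le_pos; nra.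
    - apply Rabs_le. unfold del. split; nra. }
  apply Rabs_le_between in Ht.
  assert (Hr : 0 <= rho * (s ^ 2 * v - gam * pp) <= rho1 * ((gam + 1) / 2 * del)).
  { split; [apply Rmult_le_pos; lra|]. apply Rmult_le_compat; lra. }
  unfold damping. fold P. apply Rabs_le.
  assert (0 < rho1 * del) by (apply Rmult_lt_0_compat; lra).
  assert (del < gam * del) by nra.
  assert (0 < gam * (rho1 * del)) by (apply Rmult_lt_0_compat; lra).
  split; lra.
Qed.

(** The normalized defect is bounded and relaxes towards the quotient of source
    and damping, which is within a multiple of the strength of the quotient for
    constant damping; [bounded_damped_nonpos] then applies to both signs of the
    difference.  The damping is bounded below only for weak shocks.  For the
    others the strength is bounded below, and the cap on both terms gives the
    same bound. *)
Lemma scaled_defect_close (Rg gam eps kap vm thm vp thp s rho1 : R) (V Th : R -> R) :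
  0 < eps -> 0 < kap -> shock_jump Rg gam vm thm vp thp s ->
  planar_profile Rg gam eps kap vm thm vp s V Th ->
  let rho := Rg * eps / (kap * (gam - 1)) in
  let pp := pressure Rg vp thp in
  rho <= rho1 ->
  forall x, Rabs (scaled_defect Rg vm thm vp s (V x) (Th x)
                  - (gam + 1) / 2 * rho / ((gam - 1) * pp + rho * (gam * pp)))
    <= 2 * defect_cap gam pp * ((gam + 1) * (1 + rho1)) / ((gam - 1) * pp)
       * (s ^ 2 * (vp - vm)).
Proof.
  intros He Hk Hj Hprof rho pp Hrho1 x.
  pose proof (shock_jump_pressure_pos _ _ _ _ _ _ _ Hj) as Hpp.
  pose proof (shock_profile_region _ _ _ _ _ _ _ _ _ _ _ He Hk Hj Hprof) as Hreg.
  pose proof Hj as [HR Hg Hvm Hthm Hthp Hs Hcomp _ _].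
  pose proof (strength_pos s vm vp Hs Hcomp) as Hdel.
  set (del := s ^ 2 * (vp - vm)) in *.
  assert (Hrho : 0 < rho).
  { unfold rho. apply Rdiv_lt_0_compat; apply Rmult_lt_0_compat; lra. }
  fold pp in Hpp.
  assert (Hgp : 0 < gam * pp) by (apply Rmult_lt_0_compat; lra).
  assert (Hg1p : 0 < (gam - 1) * pp) by (apply Rmult_lt_0_compat; lra).
  set (bs := (gam - 1) * pp + rho * (gam * pp)).
  assert (Hbs : (gam - 1) * pp < bs /\ rho * (gam * pp) < bs).
  { assert (0 < rho * (gam * pp)) by now apply Rmult_lt_0_compat. unfold bs; lra. }
  set (K := (gam + 1) / 2 * rho / bs).
  set (K0 := defect_cap gam pp).
  set (C1 := (gam + 1) * (1 + rho1)).
  set (C2 := 2 * K0 * C1 / ((gam - 1) * pp)).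
  set (psi := fun y => scaled_defect Rg vm thm vp s (V y) (Th y)).
  set (bt := fun y => damping Rg vm vp s rho (psi y) (V y) (Th y)).
  assert (HK0 : 0 < K0) by (apply Rdiv_lt_0_compat; lra).
  assert (HC1 : 0 < C1) by (apply Rmult_lt_0_compat; lra).
  assert (HC2 : 0 < C2).
  { apply Rdiv_lt_0_compat; [|exact Hg1p].
    apply Rmult_lt_0_compat; [|exact HC1]. apply Rmult_lt_0_compat; lra. }
  assert (HKbs : (gam + 1) / 2 * rho = K * bs) by (unfold K; field; lra).
  assert (HK : 0 < K < K0).
  { split.
    - apply Rdiv_lt_0_compat; [|lra].
      apply Rmult_lt_0_compat; lra.
    - apply (Rmult_lt_reg_r bs); [lra|]. rewrite <- HKbs.
      apply Rle_lt_trans with (K0 * (rho * (gam * pp))).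
      + right. unfold K0, defect_cap. field. lra.
      + apply Rmult_lt_compat_l; lra. }
  assert (Hpsi : forall y, 0 < psi y < K0).
  { intros y. destruct (Hreg y) as [H1 [H2 Hv]].
    destruct (scaled_defect_bounds _ _ _ _ _ _ _ _ _ Hj Hv H1 H2) as [Hp0 Hp1].
    split; [exact Hp0|].
    now apply (scaled_defect_lt_cap _ _ _ _ _ _ _ (V y) (psi y) Hj). }
  assert (Hbt : forall y, Rabs (bt y - bs) <= C1 * del).
  { intros y. destruct (Hreg y) as [H1 [H2 Hv]].
    exact (damping_close _ _ _ _ _ _ _ _ _ _ _ Hj Hv H1 H2 (conj Hrho Hrho1)). }
  change (Rabs (psi x - K) <= C2 * del).
  destruct (Rle_or_lt ((gam - 1) * pp) (2 * C1 * del)) as [Hlarge|Hsmall].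
  - apply Rle_trans with K0.
    + pose proof (Hpsi x). apply Rabs_le. lra.
    + apply Rle_trans with (C2 * del); [|lra].
      unfold C2. replace (2 * K0 * C1 / ((gam - 1) * pp) * del)
        with (K0 * (2 * C1 * del / ((gam - 1) * pp))) by (field; lra).
      assert (1 <= 2 * C1 * del / ((gam - 1) * pp)) by (apply Rle_div_r; lra).
      nra.
  (* In this case the damping loses at most half of (gam - 1) pp. *)
  - set (b0 := (gam - 1) * pp / 2).
    assert (Hb0 : forall y, b0 <= bt y).
    { intros y. pose proof (Hbt y) as Hy. apply Rabs_le_between in Hy. unfold b0. lra. }
    assert (Hes : 0 < eps * s) by now apply Rmult_lt_0_compat.
    assert (Hb0p : 0 < b0) by (unfold b0; lra).
    pose proof (is_derive_scaled_defect _ _ _ _ _ _ _ _ _ _ _ He Hk Hj Hprof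
                  (fun y => proj2 (proj2 (Hreg y)))) as Dpsi.
    fold rho psi in Dpsi. cbv zeta in Dpsi.
    assert (Cm : forall y, continuous (fun z => bt z / (eps * s)) y).
    { intros y. apply (ex_derive_continuous (fun z => bt z / (eps * s)) y).
      assert (Epsi : ex_derive psi y) by (eexists; apply Dpsi).
      assert (EV : ex_derive V y) by
        (eexists; apply (planar_V _ _ _ _ _ _ _ _ _ _ Hprof)).
      assert (ETh : ex_derive Th y) by
        (eexists; apply (planar_Th _ _ _ _ _ _ _ _ _ _ Hprof)).
      unfold bt, damping, pressure. auto_derive.
      pose proof (planar_V_pos _ _ _ _ _ _ _ _ _ _ Hprof y).
      repeat split; try assumption; lra. }
    assert (Hmb : forall y, b0 / (eps * s) <= bt y / (eps * s)).
    { intros y. apply Rmult_le_compat_r; [|apply Hb0].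
      now apply Rlt_le, Rinv_0_lt_compat. }
    assert (Hbp : 0 < b0 / (eps * s)) by now apply Rdiv_lt_0_compat.
    assert (Hmain : forall y, Rabs (K * (bs - bt y)) <= C2 * del * bt y).
    { intros y. rewrite Rabs_mult, (Rabs_right K), Rabs_minus_sym by lra.
      apply Rle_trans with (K0 * (C1 * del)).
      - apply Rmult_le_compat; try lra; [apply Rabs_pos|apply Hbt].
      - replace (K0 * (C1 * del)) with (C2 * del * b0) by (unfold C2, b0; field; lra).
        apply Rmult_le_compat_l; [|apply Hb0].
        apply Rlt_le, Rmult_lt_0_compat; lra. }
    assert (Hdamp : forall num, num <= 0 -> num / (eps * s) <= 0).
    { intros num Hnum. assert (0 < / (eps * s)) by now apply Rinv_0_lt_compat.
      unfold Rdiv. nra. }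
    apply Rabs_le. split.
    + assert (K - psi x - C2 * del <= 0); [|lra].
      apply (bounded_damped_nonpos (fun y => K - psi y - C2 * del)
        (fun y => - (((gam + 1) / 2 * rho - psi y * bt y) / (eps * s)))
        (fun y => bt y / (eps * s)) (b0 / (eps * s)) K); try assumption.
      * intros y. specialize (Dpsi y).
        auto_derive; [eexists; exact Dpsi|].
        rewrite (derive_value (fun z => psi z) y _ Dpsi). unfold bt. ring.
      * intros y. pose proof (Hpsi y).
        assert (0 < C2 * del) by now apply Rmult_lt_0_compat. lra.
      * intros y. rewrite HKbs.
        replace (- ((K * bs - psi y * bt y) / (eps * s))
                 + bt y / (eps * s) * (K - psi y - C2 * del))
          with ((- (K * (bs - bt y)) - C2 * del * bt y) / (eps * s)) by (field; lra).
        apply Hdamp. pose proof (Hmain y) as Hy. apply Rabs_le_between in Hy. lra.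
    + assert (psi x - K - C2 * del <= 0); [|lra].
      apply (bounded_damped_nonpos (fun y => psi y - K - C2 * del)
        (fun y => ((gam + 1) / 2 * rho - psi y * bt y) / (eps * s))
        (fun y => bt y / (eps * s)) (b0 / (eps * s)) K0); try assumption.
      * intros y. specialize (Dpsi y).
        auto_derive; [eexists; exact Dpsi|].
        rewrite (derive_value (fun z => psi z) y _ Dpsi). unfold bt. ring.
      * intros y. pose proof (Hpsi y).
        assert (0 < C2 * del) by now apply Rmult_lt_0_compat. lra.
      * intros y. rewrite HKbs.
        replace ((K * bs - psi y * bt y) / (eps * s)
                 + bt y / (eps * s) * (psi y - K - C2 * del))
          with ((K * (bs - bt y) - C2 * del * bt y) / (eps * s)) by (field; lra).
        apply Hdamp. pose proof (Hmain y) as Hy. apply Rabs_le_between in Hy. lra.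
Qed.

(** * Conclusion *)

(** With [a = s^2 x psi] and [b = s^2 y psi], the difference of the two chord
    slopes is exactly [psi (x + y) / ((1 - a) (1 + b))].  As
    [x + y] is of the order of [del], it is enough to know [psi] up to
    [O(del)] and the denominator up to [O(del)]. *)
Lemma chord_difference_estimate (s x y psi K K0 C2 D del P pm pp vp : R) :
  0 < s -> 0 < x -> 0 < y -> 0 < psi <= K0 ->
  del = s ^ 2 * (x + y) -> x + y <= vp -> x + y <= D * del ->
  P - pm = - (s ^ 2 * x * (1 + s ^ 2 * y * psi)) ->
  P - pp = s ^ 2 * y * (1 - s ^ 2 * x * psi) ->
  1 <= (1 - s ^ 2 * x * psi) * (1 + K0 * del) ->
  Rabs (psi - K) <= C2 * del ->
  Rabs (x / (P - pm) - - y / (P - pp) - K * (x + y))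
  <= (D * (C2 + K0 ^ 2) + vp * K0 ^ 3) * del ^ 2.
Proof.
  intros Hs Hx Hy Hpsi Hdel Hdvp HdD HPm HPp Hmargin Hclose.
  assert (Hs2 : 0 < s ^ 2) by (apply pow_lt; exact Hs).
  assert (Hdelp : 0 < del) by (rewrite Hdel; apply Rmult_lt_0_compat; lra).
  set (a := s ^ 2 * x * psi) in *. set (b := s ^ 2 * y * psi) in *.
  set (L := 1 + K0 * del) in *.
  assert (HKd : 0 < K0 * del) by (apply Rmult_lt_0_compat; lra).
  assert (HL : 1 < L) by (unfold L; lra).
  assert (Ha0 : 0 < a) by (unfold a; repeat apply Rmult_lt_0_compat; lra).
  assert (Hb0 : 0 < b) by (unfold b; repeat apply Rmult_lt_0_compat; lra).
  assert (Ha1 : 0 < 1 - a) by nra.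
  assert (Hab : a + b = del * psi) by (rewrite Hdel; unfold a, b; ring).
  assert (HT : x / (P - pm) - - y / (P - pp) = psi * (x + y) * (/ (1 - a) * / (1 + b))).
  { rewrite HPm, HPp.
    transitivity ((a + b) / s ^ 2 * (/ (1 - a) * / (1 + b))).
    - field. repeat split; lra.
    - rewrite Hab, Hdel. field. repeat split; lra. }
  rewrite HT.
  set (q := / (1 - a)) in *. set (r := / (1 + b)) in *.
  assert (Hqa : (1 - a) * q = 1) by (apply Rinv_r; lra).
  assert (Hrb : (1 + b) * r = 1) by (apply Rinv_r; lra).
  assert (Hq : 1 <= q <= L) by (split; nra).
  assert (Hr : 0 < r <= 1) by (split; [apply Rinv_0_lt_compat; lra|nra]).
  assert (Hqr : Rabs (q * r - 1) <= (a + b) * L).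
  { assert (q - 1 = a * q) by lra. assert (1 - r = b * r) by lra.
    assert (a * q <= a * L) by nra. assert (b * r <= b * L) by nra.
    assert (0 <= a * L) by nra. assert (0 <= b * L) by nra.
    apply Rabs_le. split; nra. }
  replace (psi * (x + y) * (q * r) - K * (x + y))
    with ((x + y) * ((psi - K) + psi * (q * r - 1))) by ring.
  rewrite Rabs_mult, (Rabs_right (x + y)) by lra.
  apply Rle_trans with ((x + y) * (C2 * del + K0 * (del * K0 * L))).
  { apply Rmult_le_compat_l; [lra|].
    apply Rle_trans with (1 := Rabs_triang _ _).
    apply Rplus_le_compat; [exact Hclose|].
    rewrite Rabs_mult, (Rabs_right psi) by lra.
    apply Rmult_le_compat; [lra|apply Rabs_pos|lra|].
    apply Rle_trans with (1 := Hqr). rewrite Hab.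
    apply Rmult_le_compat_r; [lra|]. apply Rmult_le_compat_l; lra. }
  unfold L.
  replace ((x + y) * (C2 * del + K0 * (del * K0 * (1 + K0 * del))))
    with ((x + y) * (C2 + K0 ^ 2) * del + (x + y) * (K0 ^ 3 * del ^ 2)) by ring.
  replace ((D * (C2 + K0 ^ 2) + vp * K0 ^ 3) * del ^ 2)
    with ((D * del) * (C2 + K0 ^ 2) * del + vp * (K0 ^ 3 * del ^ 2)) by ring.
  assert (HC2 : 0 <= C2).
  { pose proof (Rabs_pos (psi - K)). nra. }
  apply Rplus_le_compat.
  - apply Rmult_le_compat_r; [lra|]. apply Rmult_le_compat_r; [|exact HdD]. nra.
  - apply Rmult_le_compat_r; [|exact Hdvp].
    apply Rmult_le_pos; apply pow_le; lra.
Qed.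

Theorem lemma2p2 (Rg gam vp up thp : R) (kappa : R -> R)
  (hRg : 0 < Rg) (hgam : 1 < gam) (hvp : 0 < vp) (hthp : 0 < thp)
  (hkappa_pos : forall eps : R, 0 < eps -> 0 < kappa eps)
  (hkappa_bounds : exists c1 c2 : R, 0 < c1 /\ 0 < c2 /\
     forall eps : R, 0 < eps -> c1 <= kappa eps / eps <= c2) :
  exists C : R, 0 < C /\
    forall (eps vm um thm s3 : R) (V U Th : R -> R),
      0 < eps -> 0 < vm -> 0 < thm ->
      is_3shock Rg gam vm um thm vp up thp s3 ->
      is_viscous_3shock Rg gam eps (kappa eps) vm um thm vp up thp s3 V U Th ->
      let pm := pressure Rg vm thm in
      let pp := pressure Rg vp thp in
      let P := fun xi : R => pressure Rg (V xi) (Th xi) in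
      let delta := Rabs (pm - pp) in
      forall xi : R,
        Rabs ((V xi - vm) / (P xi - pm) - (V xi - vp) / (P xi - pp)
              - (gam + 1) / (2 * gam * pp)
                * (Rg * eps * gam
                   / (kappa eps * (gam - 1) ^ 2 + Rg * eps * gam))
                * (vp - vm))
        <= C * delta ^ 2.
Proof.
  destruct hkappa_bounds as [c1 [c2 [hc1 [_ hkappa]]]].
  pose proof (pressure_pos Rg vp thp hRg hvp hthp) as Hpp.
  set (pp0 := pressure Rg vp thp) in Hpp.
  set (rho1 := Rg / (c1 * (gam - 1))).
  set (K0 := defect_cap gam pp0).
  set (C2 := 2 * K0 * ((gam + 1) * (1 + rho1)) / ((gam - 1) * pp0)).
  set (D := vp / (gam * pp0)).
  assert (Hg1p : 0 < (gam - 1) * pp0) by (apply Rmult_lt_0_compat; lra).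
  assert (Hgp : 0 < gam * pp0) by (apply Rmult_lt_0_compat; lra).
  assert (Hrho1 : 0 < rho1).
  { apply Rdiv_lt_0_compat; [lra|]. apply Rmult_lt_0_compat; lra. }
  assert (HK0 : 0 < K0) by (apply Rdiv_lt_0_compat; lra).
  assert (HC2 : 0 < C2).
  { apply Rdiv_lt_0_compat; [|exact Hg1p]. apply Rmult_lt_0_compat.
    - lra.
    - apply Rmult_lt_0_compat; lra. }
  assert (HD : 0 < D) by now apply Rdiv_lt_0_compat.
  exists (D * (C2 + K0 ^ 2) + vp * K0 ^ 3). split.
  { apply Rplus_lt_0_compat; apply Rmult_lt_0_compat; try assumption.
    - pose proof (pow_lt K0 2 HK0). lra.
    - now apply pow_lt. }
  intros eps vm um thm s V U Th He Hvm Hthm Hshock Hvisc pm pp P delta xi.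
  assert (Hk : 0 < kappa eps) by now apply hkappa_pos.
  set (kap := kappa eps) in *.
  pose proof (shock_jump_of_3shock _ _ _ _ _ _ _ _ _
                hRg hgam Hvm Hthm hvp hthp Hshock) as Hj.
  pose proof (planar_profile_of_viscous_shock _ _ _ _ _ _ _ _ _ _ _ _ _ _
                He Hk Hj Hvisc) as Hprof.
  destruct (shock_profile_region _ _ _ _ _ _ _ _ _ _ _ He Hk Hj Hprof xi) as [H1 [H2 Hv]].
  destruct (scaled_defect_bounds _ _ _ _ _ _ _ _ _ Hj Hv H1 H2) as [Hpsi Hpsiv].
  pose proof Hj as [_ _ _ _ _ Hs Hcomp Hp Hsp].
  pose proof (strength_pos s vm vp Hs Hcomp) as Hdel.
  set (rho := Rg * eps / (kap * (gam - 1))).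
  assert (Hrho : rho <= rho1).
  { destruct (hkappa eps He) as [Hc1 _]. fold kap in Hc1.
    apply Rle_div_r in Hc1; [|exact He].
    unfold rho, rho1. apply Rle_div_l; [apply Rmult_lt_0_compat; lra|].
    replace (Rg / (c1 * (gam - 1)) * (kap * (gam - 1))) with (Rg * (kap / c1))
      by (field; lra).
    apply Rmult_le_compat_l; [lra|]. apply Rle_div_r; lra. }
  pose proof (scaled_defect_close _ _ _ _ _ _ _ _ _ rho1 V Th
                He Hk Hj Hprof Hrho xi) as Hclose.
  pose proof (pressure_margin _ _ _ _ _ _ _ _ _ Hj Hv Hpsi Hpsiv) as Hmargin.
  pose proof (scaled_defect_spec Rg vm thm vp s (V xi) (Th xi) Hs Hv) as Hspec.
  set (psi := scaled_defect Rg vm thm vp s (V xi) (Th xi)) in *.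
  fold rho in Hclose. fold pp0 K0 in Hclose, Hmargin. fold C2 in Hclose.
  fold pm pp in Hp. unfold momentum_defect in Hspec. fold (P xi) pm in Hspec.
  assert (Hdelta : delta = s ^ 2 * (vp - vm)).
  { unfold delta. rewrite Hp. rewrite Rabs_right; lra. }
  assert (Hs2 : 0 < s ^ 2) by (apply pow_lt; exact Hs).
  replace ((gam + 1) / (2 * gam * pp)
           * (Rg * eps * gam / (kap * (gam - 1) ^ 2 + Rg * eps * gam)) * (vp - vm))
    with ((gam + 1) / 2 * rho / ((gam - 1) * pp0 + rho * (gam * pp0))
          * ((V xi - vm) + (vp - V xi))).
  2: { unfold rho. change pp with pp0.
       assert (0 < kap * (gam - 1) ^ 2)
         by (apply Rmult_lt_0_compat; [lra|apply pow_lt; lra]).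
       assert (0 < Rg * eps) by now apply Rmult_lt_0_compat.
       assert (0 < Rg * eps * gam) by (apply Rmult_lt_0_compat; lra).
       field. repeat split; try lra.
       replace ((gam - 1) * pp0 * (kap * (gam - 1)) + Rg * eps * (gam * pp0))
         with (pp0 * (kap * (gam - 1) ^ 2 + Rg * eps * gam)) by ring.
       apply Rmult_integral_contrapositive_currified; lra. }
  replace (V xi - vp) with (- (vp - V xi)) by ring.
  apply (chord_difference_estimate s (V xi - vm) (vp - V xi) psi _ K0 C2 D); try lra.
  - pose proof (scaled_defect_lt_cap _ _ _ _ _ _ _ _ _ Hj (proj1 Hv) Hpsi Hpsiv) as Hcap.
    fold pp0 K0 in Hcap. lra.
  - rewrite Hdelta. unfold D.
    replace (vp / (gam * pp0) * (s ^ 2 * (vp - vm)))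
      with ((vp - vm) * (s ^ 2 * vp / (gam * pp0))) by (field; lra).
    assert (1 <= s ^ 2 * vp / (gam * pp0)).
    { apply Rle_div_r; [exact Hgp|]. fold pp0 in Hsp. rewrite Hsp.
      assert (0 < (gam + 1) / 2 * (s ^ 2 * (vp - vm))) by (apply Rmult_lt_0_compat; lra).
      lra. }
    nra.
  - rewrite Hdelta. exact Hmargin.
  - rewrite Hdelta. exact Hclose.
Qed.
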